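(* For $i=1,\dots,n$, $$Q_i(x,z)=\sum_{m\ge0}\ \sum_{\substack{l_0+\dots+l_m=M\\ l_0,\dots,l_m>0}}\frac{\Phi(x,z)}{(x-z_i)^{l_0}}\prod_{r=1}^m\frac{C_{i,l_r}(z)}{l_1+\dots+l_r},$$ $$\frac{\partial Q_i}{\partial x}(x,z)=\sum_{m\ge0}\ \sum_{\substack{l_0+\dots+l_m=M\\ l_0,\dots,l_m>0}}\Big(D_{i,l_0}(x,z)-C_{i,l_0}(z)\frac{\Phi(x,z)}{x-z_i}\Big)\prod_{r=1}^m\frac{C_{i,l_r}(z)}{l_1+\dots+l_r}.$$
   Context: Let $p,q$ be prime numbers, $k$ a positive integer, $n=kq+1$, and $p>n$. Let $z=(z_1,\dots,z_n)$, and let $\mathbb{F}_p(z)=\mathbb{F}_p(z_1,\dots,z_n)$ be the field of rational functions. Let $a$ be the unique integer with $1\le a<q$ and $q\mid(ap-1)$; put $M=(ap-1)/q\in\mathbb{Z}_{>0}$. Let $\Phi(x,z)=\prod_{i=1}^n(x-z_i)^M$ over $\mathbb{F}_p$. The space $\Omega_{\log}$ is the $\mathbb{F}_p(z)$-span of the polynomials $\frac{\Phi(x,z)}{x-z_j}$, $j=1,\dots,n$. For $i=1,\dots,n$, $Q_i(x,z)\in\mathbb{F}_p(z)[x]$ is the polynomial $$Q_i(x,z)=\frac{\Phi(x,z)}{(x-z_i)^M}+\sum_{m=1}^{M-1}A_{i,m}(z)\frac{\Phi(x,z)}{(x-z_i)^m},$$ where $A_{i,1}(z),\dots,A_{i,M-1}(z)\in\mathbb{F}_p(z)$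 are the coefficients (they exist and are unique) for which $\frac{\partial Q_i}{\partial x}\in\Omega_{\log}$. For $m\ge1$, $$C_{i,m}(z)=\sum_{\substack{1\le j\le n\\ j\ne i}}\frac{M}{(z_j-z_i)^m},\qquad D_{i,m}(x,z)=\sum_{\substack{1\le j\le n\\ j\ne i}}\frac{M}{(z_j-z_i)^m}\,\frac{\Phi(x,z)}{x-z_j}.$$ The sums in the claim range over all integers $m\ge0$ and all $(m+1)$-tuples of positive integers $(l_0,\dots,l_m)$ with sum $M$. For $m=0$ the empty product equals $1$. The integers $l_1+\dots+l_r$ in the denominators are regarded as elements of $\mathbb{F}_p$. *)

(* Defs.v *)
From mathcomp Require Import all_boot all_order all_algebra.
From mathcomp.multinomials Require Export mpoly.
From Stdlib Require Import ClassicalEpsilon.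

Set Implicit Arguments.
Unset Strict Implicit.
Unset Printing Implicit Defensive.

Import GRing.Theory.
Local Open Scope ring_scope.

(* F_p(z_1, ..., z_n); 'F_p is the field with p elements when p is prime. *)
Definition Fpz (p n : nat) := {fraction {mpoly 'F_p[n]}}.

Section Polynomials.

Variables (p n M : nat).
Local Notation F := (Fpz p n).

Definition zvar (i : 'I_n) : F := FracField.tofrac ('X_i : {mpoly 'F_p[n]}).

Definition Phi : {poly F} := \prod_(i < n) ('X - (zvar i)%:P) ^+ M.

(* Phi / (x - z_i)^l.  It is only used for l <= M, where the polynomial
   division is exact. *)
Definition Phi_over (i : 'I_n) (l : nat) : {poly F} :=
  Phi %/ ('X - (zvar i)%:P) ^+ l.

Definition Omega_log (P : {poly F}) : Prop :=
  exists c : 'I_n -> F, P = \sum_(j < n) c j *: Phi_over j 1.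

(* Only the values A m with 1 <= m <= M - 1 matter. *)
Definition Qansatz (i : 'I_n) (A : nat -> F) : {poly F} :=
  Phi_over i M + \sum_(1 <= m < M) A m *: Phi_over i m.

(* The coefficients for which the derivative lies in Omega_log.  They are
   obtained by choice: existence, and uniqueness in the range 1 <= m <= M - 1,
   are not assumed here. *)
Definition Acoef (i : 'I_n) : nat -> F :=
  epsilon (inhabits (fun _ => 0))
    (fun A : nat -> F => Omega_log (Qansatz i A)^`()).

Definition Q (i : 'I_n) : {poly F} := Qansatz i (Acoef i).

Definition C (i : 'I_n) (m : nat) : F :=
  \sum_(j < n | j != i) M%:R / (zvar j - zvar i) ^+ m.

Definition D (i : 'I_n) (m : nat) : {poly F} :=
  \sum_(j < n | j != i) (M%:R / (zvar j - zvar i) ^+ m) *: Phi_over j 1.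

(* (l_0, ..., l_m) with positive entries and sum M.  The codomain 'I_M.+1 is
   no restriction, since each entry is at most the sum M. *)
Definition composition (m : nat) (l : {ffun 'I_m.+1 -> 'I_M.+1}) : bool :=
  [forall r, (0 < l r)%N] && ((\sum_(r < m.+1) l r)%N == M).

(* prod_(r = 1)^m C_(i, l_r) / (l_1 + ... + l_r) *)
Definition Cprod (i : 'I_n) (m : nat) (l : {ffun 'I_m.+1 -> 'I_M.+1}) : F :=
  \prod_(r < m.+1 | (0 < r)%N)
     (C i (l r) / (\sum_(s < m.+1 | (0 < s <= r)%N) l s)%N%:R).

(* Sum over all m >= 0 and all positive (m+1)-tuples with sum M.  Such tuples
   exist only if m + 1 <= M, hence the bound on m. *)
Definition sum_compositions
    (T : forall m : nat, {ffun 'I_m.+1 -> 'I_M.+1} -> {poly F}) : {poly F} :=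
  \sum_(m < M) \sum_(l : {ffun 'I_m.+1 -> 'I_M.+1} | composition l) T m l.

End Polynomials.

(* Main.v *)
Require Import Defs.
From mathcomp Require Import all_boot all_order all_algebra ring zify.

Import GRing.Theory.
Local Open Scope ring_scope.

(* Write w = x - z_i, Phi = w^M G and T_l = Phi / w^l.  Expanding each
   1 / (x - z_j) in G' / G as a finite geometric series in w gives
     T_l' = (M - l) T_(l+1) + D_l - sum_(1 <= s <= l) C_s T_(l-s+1).
   Hence the derivative of sum_N E_N T_(M-N), with E_0 = 1, has no pole term
   T_l with l > 1 as soon as N E_N = sum_(1 <= s <= N) C_s E_(N-s), which is
   solvable because M < p; unrolling this recursion, the last part of the
   composition being s, gives the sum over compositions.  The ansatz is unique:
   the difference of two solutions is R G with w | R, deg R < M and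
   w^(M-1) | (R G)', whereas differentiation lowers the order of vanishing at
   z_i by exactly one when this order is between 1 and M - 1. *)

(** * Reindexing of finite sums and the derivative of a product *)

(** Both sides run over the pairs (a, s) with a + s + 1 < M, on the left grouped by N = a + s +
    1. *)
Lemma sum_triangle_reindex (V : nmodType) (f : nat -> nat -> V) (M : nat) :
  \sum_(N < M) \sum_(s < N) f (N - s.+1)%N s
    = \sum_(N < M) \sum_(s < M - N.+1) f N s.
Proof.
elim: M => [|M IHM]; first by rewrite !big_ord0.
rewrite !big_ord_recr /= subnn big_ord0 addr0 IHM.
rewrite [X in _ + X](reindex_inj rev_ord_inj) -big_split /=.
apply: eq_bigr => N _; rewrite subSS.
have -> : (M - N = (M - N.+1).+1)%N by have := ltn_ord N; lia.
by rewrite big_ord_recr /=; congr (_ + f _ _); have := ltn_ord N; lia.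
Qed.

(** The bijection splits off the last value [u]: [unlift ord_max r] is [None] exactly at the last
    index. *)
Lemma sum_ffun_ord_recr (V : nmodType) (A : finType) (m : nat)
    (P : pred {ffun 'I_m.+1 -> A}) (f : {ffun 'I_m.+1 -> A} -> V) :
  \sum_(l | P l) f l
    = \sum_(u : A) \sum_(l : {ffun 'I_m -> A}
        | P [ffun r => oapp l u (unlift ord_max r)])
        f [ffun r => oapp l u (unlift ord_max r)].
Proof.
pose h (x : A * {ffun 'I_m -> A}) : {ffun 'I_m.+1 -> A} :=
  [ffun r => oapp x.2 x.1 (unlift ord_max r)].
rewrite (pair_big_dep predT) /= (reindex h) //=; exists
  (fun l : {ffun 'I_m.+1 -> A} => (l ord_max, [ffun r => l (lift ord_max r)])).
- move=> [u l] _; rewrite /h /= ffunE unlift_none; congr (_, _).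
  by apply/ffunP => r; rewrite !ffunE liftK.
- move=> l _; apply/ffunP => r; rewrite ffunE /=.
  by case: unliftP => [j|] -> /=; rewrite ?ffunE.
Qed.

Lemma deriv_prod (R : comNzRingType) (I : eqType) (r : seq I) (f : I -> {poly R}) :
  uniq r ->
  (\prod_(j <- r) f j)^`()
    = \sum_(j <- r) (f j)^`() * \prod_(u <- r | u != j) f u.
Proof.
elim: r => [|x r IHr] /=; first by rewrite !big_nil derivE.
case/andP=> xr r_uniq; rewrite !big_cons derivM IHr // eqxx /=; congr (_ * _ + _).
  rewrite big_seq [RHS]big_seq_cond; apply: eq_bigl => j.
  by case jr: (j \in r) => //=; apply/esym; apply: contraNneq xr => <-.
rewrite mulr_sumr [LHS]big_seq [RHS]big_seq; apply: eq_bigr => j jr.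
rewrite big_cons ifT; first by rewrite mulrCA.
by apply: contraNneq xr => ->.
Qed.

(** * Weights of compositions and their recursion *)

(* Sum over the compositions (l_1, ..., l_m) of N of the weights
   prod_r c (l_r) / (l_1 + ... + l_r), computed from the last part l_m. *)
Fixpoint comp_weight (K : fieldType) (c : nat -> K) (m N : nat) : K :=
  if m is m'.+1 then
    (\sum_(s < N) c s.+1 * comp_weight K c m' (N - s.+1)) / N%:R
  else (N == 0)%N%:R.

Lemma comp_weight_eq0 (K : fieldType) (c : nat -> K) (m N : nat) :
  (N < m)%N -> comp_weight K c m N = 0.
Proof.
elim: m N => //= m IHm N ltNm.
by rewrite big1 ?mul0r // => s _; rewrite IHm ?mulr0 //; have := ltn_ord s; lia.
Qed.

(** Induction on m, removing the last part. The first part is fixed to [h] and enters no weight, so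
    the value does not depend on [h]; [h + N <= b] lets every part fit into ['I_b.+1]. *)
Lemma sum_composition_weight (K : fieldType) (c : nat -> K) (b m h N : nat) :
  (0 < h)%N -> (h + N <= b)%N ->
  \sum_(l : {ffun 'I_m.+1 -> 'I_b.+1} | [&& [forall r, 0 < l r],
        \sum_(r < m.+1) l r == h + N & l ord0 == h :> nat]%N)
     \prod_(r < m.+1 | (0 < r)%N)
        (c (l r) / (\sum_(s < m.+1 | (0 < s <= r)%N) l s)%N%:R)
    = comp_weight K c m N.
Proof.
move=> h_gt0; elim: m N => [|m IHm] N hNb /=.
  under eq_bigr do rewrite big_ord1_cond /=.
  under eq_bigl do rewrite big_ord1.
  have [->|N_neq0] := eqVneq N 0%N; last first.
    by rewrite big_pred0 // => l; apply/and3P=> -[_ /eqP-> /eqP]; lia.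
  rewrite (big_pred1 [ffun => inord h]) // => l; rewrite addn0.
  apply/and3P/eqP=> [[_ /eqP lh _]|->].
    apply/ffunP => r; rewrite ord1 ffunE; apply/val_inj.
    by rewrite /= inordK; [exact: lh|lia].
  rewrite ffunE inordK ?eqxx; last by lia.
  by split=> //; apply/forallP => r; rewrite ffunE inordK //; lia.
(* Positivity excludes the last part 0; the other last parts [lift ord0 u] are u + 1, as in
   [comp_weight]. *)
rewrite sum_ffun_ord_recr big_ord_recl [X in X + _]big_pred0 ?add0r; last first.
  move=> l; apply/and3P=> -[/forallP/(_ ord_max)].
  by rewrite ffunE unlift_none.
rewrite mulr_suml (big_ord_widen b (fun s => c s.+1 * _ (N - s.+1)%N / _)); last by lia.
rewrite [RHS]big_mkcond; apply: eq_bigr => u _.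
pose L (l : {ffun 'I_m.+1 -> 'I_b.+1}) : {ffun 'I_m.+2 -> 'I_b.+1} :=
  [ffun r => oapp l (lift ord0 u) (unlift ord_max r)].
have L_widen l r : L l (widen_ord (leqnSn m.+1) r) = l r.
  rewrite ffunE; have -> : widen_ord (leqnSn m.+1) r = lift ord_max r.
    by apply/val_inj; rewrite /= /bump leqNgt ltn_ord.
  by rewrite liftK.
have L_max l : L l ord_max = lift ord0 u by rewrite ffunE unlift_none.
have L0 l : L l ord0 = l ord0.
  by rewrite -(L_widen l); congr (L l _); apply/val_inj.
have L_sum l : (\sum_(r < m.+2) L l r = \sum_(r < m.+1) l r + u.+1)%N.
  by rewrite big_ord_recr L_max /=; under eq_bigr do rewrite L_widen.
have L_pos l : [forall r, (0 < L l r)%N] = [forall r, (0 < l r)%N].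
  apply/forallP/forallP => [Lr r|lr r]; first by rewrite -L_widen.
  by rewrite ffunE; case: unliftP => [j|] _ /=; first exact: lr.
under eq_bigl => l do rewrite -/(L l) L0 L_sum L_pos.
(* The first part takes [h], so a last part u + 1 > N would exceed the total. *)
case: ifPn => [ltuN|]; last first.
  rewrite -leqNgt => leNu; rewrite big_pred0 // => l.
  apply/and3P=> -[_ /eqP l_sum /eqP lh].
  by move: l_sum; rewrite big_ord_recl; lia.
have hNu : (h + (N - u.+1) <= b)%N by lia.
rewrite -(IHm _ hNu) mulrAC mulr_sumr.
apply: eq_big => [l|l /and3P[_ /eqP l_sum /eqP lh]].
  by congr [&& _, _ & _]; apply/eqP/eqP; lia.
rewrite -/(L l) big_mkcond big_ord_recr /= -big_mkcond mulrC L_max.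
(* The last denominator is the sum of all parts but the first, which is N; the earlier ones do not
   involve the last part. *)
congr (_ / _%:R * _).
  move: (L_sum l); rewrite big_ord_recl L0 => Ll_sum.
  rewrite big_mkcond big_ord_recl /= add0n.
  rewrite (eq_bigr (fun s => L l (lift ord0 s) : nat)).
    by apply: (@addnI (l ord0)); rewrite [LHS]Ll_sum l_sum lh.
  by move=> s _; rewrite /bump /= add1n ltnS -ltnS ltn_ord.
apply: eq_bigr => r _; rewrite L_widen; congr (_ / _%:R).
rewrite big_mkcond big_ord_recr -big_mkcond /= ltnNge -ltnS ltn_ord addn0.
by apply: eq_bigr => s _; rewrite L_widen.
Qed.

(** A composition of N has at most N parts, so for N < b the sum over m < b is complete and shifting
    m leaves no boundary term. *)
Lemma sum_comp_weight_rec (K : fieldType) (c : nat -> K) (b N : nat) :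
  (N < b)%N -> N%:R != 0 :> K ->
  N%:R * (\sum_(m < b) comp_weight K c m N)
    = \sum_(s < N) c s.+1 * \sum_(m < b) comp_weight K c m (N - s.+1).
Proof.
case: b => // b ltNb N_neq0; rewrite big_ord_recl /=.
have -> : N == 0%N = false by apply: contraNF N_neq0 => /eqP->.
rewrite add0r -mulr_suml mulrC divfK // exchange_big.
apply: eq_bigr => s _; rewrite big_ord_recr /= comp_weight_eq0 ?addr0 ?mulr_sumr //.
by have := ltn_ord s; lia.
Qed.

(** * Derivatives, expansions and orders of vanishing over a field *)

(** Logarithmic derivative of G, with [g j] standing for G / (x - z_j). *)
Lemma deriv_prod_XsubC_exp (K : fieldType) (I : finType) (P : pred I) (z : I -> K)
    (M : nat) (g : I -> {poly K}) :
  let G := \prod_(j | P j) ('X - (z j)%:P) ^+ M in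
  (forall j, P j -> g j * ('X - (z j)%:P) = G) ->
  G^`() = M%:R *: \sum_(j | P j) g j.
Proof.
move=> G gE; rewrite {1}/G -big_filter deriv_prod ?filter_uniq ?index_enum_uniq //.
rewrite big_filter scaler_sumr; apply: eq_bigr => j Pj.
have w_neq0 : 'X - (z j)%:P != 0 by rewrite polyXsubC_eq0.
apply: (mulIf w_neq0); rewrite -scalerAl gE // big_filter_cond.
rewrite deriv_exp derivXsubC mul1r [in RHS]/G [in RHS](bigD1 j) //= scaler_nat.
case: M {G gE} => [|M]; first by rewrite mulr0n !mul0r mulr0n.
by rewrite !mulrnAl exprSr mulrAC.
Qed.

(** With w = x - z0 and d = z1 - z0, multiplying x - z1 = w - d by g gives g = (w g - G) / d, which
    is iterated l times. *)
Lemma geometric_expansion (K : fieldType) (z0 z1 : K) (k l : nat) (G g : {poly K}) :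
  z1 != z0 -> g * ('X - z1%:P) = G ->
  ('X - z0%:P) ^+ k * g
    = (z1 - z0) ^- l *: (('X - z0%:P) ^+ (k + l) * g)
      - \sum_(s < l) (z1 - z0) ^- s.+1 *: (('X - z0%:P) ^+ (k + s) * G).
Proof.
rewrite -subr_eq0; set d := z1 - z0 => d_neq0 gE.
elim: l => [|l ->]; first by rewrite big_ord0 subr0 addn0 expr0 invr1 scale1r.
rewrite big_ord_recr /= opprD addrCA addrC; congr (_ + _).
have GE : G = ('X - z0%:P) * g - d *: g.
  by rewrite -gE /d -mul_polyC polyCB; ring.
move: ('X - z0%:P) GE => w GE.
rewrite -scalerBr addnS [_ ^+ (k + l).+1]exprSr GE mulrBr -mulrA opprB.
rewrite addrC subrK -scalerAr scalerA.
by congr (_ *: _); rewrite exprS invfM mulrAC mulVf ?mul1r.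
Qed.

Lemma eq0_of_dvdp_deriv (K : fieldType) (a : K) (M : nat) (G R : {poly K}) :
  (forall v, (0 < v < M)%N -> v%:R != 0 :> K) ->
  ~~ root G a -> (size R <= M)%N -> 'X - a%:P %| R ->
  ('X - a%:P) ^+ M.-1 %| (R * G)^`() -> R = 0.
Proof.
move=> char_gt Ga sizeR wR wP; apply/eqP; apply: contraT => R_neq0.
have [v [S]] := multiplicity_XsubC R a; rewrite R_neq0 /= => Sa RE.
have v_gt0 : (0 < v)%N.
  case: v RE => // RE; move: wR Sa.
  by rewrite RE expr0 mulr1 dvdp_XsubCl => ->.
have ltvM : (v < M)%N.
  apply: leq_trans sizeR; have := dvdp_leq R_neq0 (_ : ('X - a%:P) ^+ v %| R).
  by rewrite size_exp_XsubC; apply; rewrite RE dvdp_mull.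
have : ('X - a%:P) ^+ v %| (R * G)^`().
  by apply: dvdp_trans wP; apply: dvdp_exp2l; lia.
(* In (S G)' (x - a)^v + v S G (x - a)^(v-1) the first term is divisible by (x - a)^v; since v is
   invertible, x - a would divide S G. *)
rewrite RE mulrAC derivM deriv_exp derivXsubC mul1r dvdp_addr; last exact: dvdp_mull.
case: v v_gt0 ltvM {RE} => // v _ ltvM.
rewrite exprS /= -scaler_nat -scalerAr dvdpZr ?char_gt //.
rewrite dvdp_mul2r ?expf_neq0 ?polyXsubC_eq0 //.
by rewrite dvdp_XsubCl rootM (negPf Sa) (negPf Ga).
Qed.

(** The formula for T_l' with T_l = w^(M-l) G. At l = M the exponent M - (l + 1) is truncated to 0,
    but its coefficient M - l vanishes. *)
Lemma deriv_partial_fraction (K : fieldType) (I : finType) (P : pred I) (z : I -> K)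
    (z0 : K) (M l : nat) (g : I -> {poly K}) :
  let w := 'X - z0%:P in
  let G := \prod_(j | P j) ('X - (z j)%:P) ^+ M in
  let c m := \sum_(j | P j) M%:R / (z j - z0) ^+ m in
  (forall j, P j -> z j != z0) ->
  (forall j, P j -> g j * ('X - (z j)%:P) = G) ->
  (l <= M)%N ->
  (w ^+ (M - l) * G)^`()
    = (M - l)%:R *: (w ^+ (M - l.+1) * G)
      + \sum_(j | P j) (M%:R / (z j - z0) ^+ l) *: (w ^+ M * g j)
      - \sum_(s < l) c s.+1 *: (w ^+ (M - (l - s)) * G).
Proof.
move=> w G c zP gE leM.
rewrite derivM deriv_exp derivXsubC mul1r (deriv_prod_XsubC_exp _ _ _ _ _ g gE).
rewrite -/G -addrA subnS -scaler_nat -scalerAl; congr (_ + _).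
rewrite -scalerAr mulr_sumr.
(* After l expansion steps w^(M-l) has become w^M, so the remainder is a multiple of w^M G / (x -
   z_j), a term of D_l. *)
have step j : P j -> w ^+ (M - l) * g j = (z j - z0) ^- l *: (w ^+ M * g j)
     - \sum_(s < l) (z j - z0) ^- s.+1 *: (w ^+ (M - (l - s)) * G).
  move=> Pj; rewrite (geometric_expansion K z0 (z j) _ l G) ?zP ?gE // subnK //.
  congr (_ - _); apply: eq_bigr => s _; congr (_ *: (_ ^+ _ * _)).
  by have := ltn_ord s; lia.
rewrite (eq_bigr _ step) big_split /= scalerDr scaler_sumr; congr (_ + _).
  by apply: eq_bigr => j _; rewrite scalerA.
rewrite sumrN scalerN exchange_big /= scaler_sumr; congr (- _).
apply: eq_bigr => s _; rewrite -scaler_suml scalerA; congr (_ *: _).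
by rewrite mulr_sumr.
Qed.

Lemma dvdp_sum_scale (K : fieldType) (I : Type) (r : seq I) (Q : pred I)
    (c : I -> K) (P : I -> {poly K}) (d : {poly K}) :
  (forall u, Q u -> d %| P u) -> d %| \sum_(u <- r | Q u) c u *: P u.
Proof.
move=> dP; apply: (big_ind (fun S => d %| S)); first by rewrite dvdp0.
  by move=> S S' dS dS'; rewrite dvdp_add.
by move=> u Qu; rewrite -mul_polyC dvdp_mull ?dP.
Qed.

Lemma divp_XsubC_exp_mul (K : fieldType) (a : K) (M l : nat) (G : {poly K}) :
  (l <= M)%N ->
  (('X - a%:P) ^+ M * G) %/ ('X - a%:P) ^+ l = ('X - a%:P) ^+ (M - l) * G.
Proof.
move=> leM; rewrite -{1}(subnK leM) exprD mulrAC.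
by rewrite mulpK // expf_neq0 ?polyXsubC_eq0.
Qed.

Lemma deriv_sum_telescope (K : fieldType) (M : nat) (E c : nat -> K)
    (T W : nat -> {poly K}) :
  (forall l, (l <= M)%N ->
     (T l)^`() = (M - l)%:R *: T l.+1 + W l - \sum_(s < l) c s.+1 *: T (l - s)%N) ->
  (forall N, (N < M)%N -> N%:R * E N = \sum_(s < N) c s.+1 * E (N - s.+1)%N) ->
  (\sum_(N < M) E N *: T (M - N)%N)^`()
    = \sum_(N < M) E N *: (W (M - N)%N - c (M - N)%N *: T 1%N).
Proof.
move=> derivT E_rec; pose f N s := (c s.+1 * E N) *: T (M - N - s)%N.
have term (N : 'I_M) : (E N *: T (M - N)%N)^`()
    = E N *: (W (M - N)%N - c (M - N)%N *: T 1%N)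
      + (\sum_(s < N) f (N - s.+1)%N s - \sum_(s < M - N.+1) f N s).
  have ltNM := ltn_ord N.
  have lE : (M - N = (M - N.+1).+1)%N by lia.
  rewrite derivZ derivT ?leq_subr // subKn ?(ltnW ltNM) //.
  (* The recursion for E turns the term coming from the derivative of w^N into a sum of the same
     shape as the C terms. *)
  have -> : \sum_(s < N) f (N - s.+1)%N s = (E N * N%:R) *: T (M - N).+1.
    rewrite mulrC E_rec // scaler_suml; apply: eq_bigr => s _.
    by congr (_ *: T _); have := ltn_ord s; lia.
  (* The last index s = M - N - 1 gives the simple pole T_1, which survives; the rest cancels after
     summing over N. *)
  have -> : \sum_(s < M - N) c s.+1 *: T (M - N - s)%N
      = \sum_(s < M - N.+1) c s.+1 *: T (M - N - s)%N + c (M - N)%N *: T 1%N.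
    rewrite -(big_mkord predT (fun s => c s.+1 *: T (M - N - s)%N)) lE.
    by rewrite big_nat_recr //= subSnn big_mkord.
  have -> : \sum_(s < M - N.+1) f N s
      = E N *: \sum_(s < M - N.+1) c s.+1 *: T (M - N - s)%N.
    by rewrite scaler_sumr; apply: eq_bigr => s _; rewrite scalerA mulrC.
  by rewrite -scalerA -scalerBr -scalerDr opprD addrACA addrC.
rewrite raddf_sum (eq_bigr _ (fun N _ => term N)) big_split sumrB /=.
by rewrite sum_triangle_reindex subrr addr0.
Qed.

(** * The explicit ansatz over F_p(z) and its derivative *)

Section LogAnsatz.

Variables (p n M : nat).
Local Notation F := (Fpz p n).
Local Notation w i := ('X - (zvar p i)%:P).

(* The coefficient of Phi / (x - z_i)^(M - N) in Q_i. *)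
Definition Qcoef (i : 'I_n) (N : nat) : F :=
  \sum_(m < M) comp_weight F (C p M i) m N.

(** Groups the compositions by their first part M - N; the remaining parts sum to N and carry the
    weights. *)
Lemma sum_compositionsE (i : 'I_n) (V : nat -> {poly F}) :
  @sum_compositions p n M (fun m l => Cprod p i l *: V (l ord0))
    = \sum_(N < M) Qcoef i N *: V (M - N)%N.
Proof.
under [RHS]eq_bigr do rewrite /Qcoef scaler_suml.
rewrite exchange_big; apply: eq_bigr => m _.
rewrite (partition_big (fun l : {ffun 'I_m.+1 -> 'I_M.+1} => l ord0) predT) //=.
rewrite big_ord_recl [X in X + _]big_pred0 ?add0r; last first.
  move=> l; apply/negP => /andP[/andP[/forallP/(_ ord0) l0 _] /eqP l0E].
  by rewrite l0E in l0.
rewrite (reindex_inj rev_ord_inj) /=; apply: eq_bigr => N _.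
have ltNM := ltn_ord N.
have hE : (M - N = (M - N.+1).+1)%N by lia.
have hN : (M - N + N <= M)%N by lia.
have h_gt0 : (0 < M - N)%N by lia.
rewrite -(sum_composition_weight F (C p M i) M m _ N h_gt0 hN) scaler_suml.
apply: eq_big => [l|l /andP[_ /eqP->]]; last by rewrite hE.
by rewrite -andbA subnK ?(ltnW ltNM) // hE.
Qed.

Lemma zvar_inj : injective (@zvar p n).
Proof.
move=> i j /eqP; rewrite tofrac_eq => /eqP/(congr1 (fun P => P@_U_(i)%MM)).
by rewrite !mcoeffXU eqxx; case: eqVneq => // _ /eqP.
Qed.

Hypotheses (p_prime : prime p) (M_gt0 : (0 < M)%N) (ltMp : (M < p)%N).

Lemma natr_Fpz_neq0 (v : nat) : (0 < v < M)%N -> v%:R != 0 :> F.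
Proof.
move=> vM; have pF : p \in [pchar F].
  have := pchar_Fp p_prime.
  move/(rmorph_pchar (@mpolyC n 'F_p)).
  by move/(rmorph_pchar (@FracField.tofrac {mpoly 'F_p[n]})).
rewrite -(dvdn_pcharf pF); apply/negP => /dvdn_leq; lia.
Qed.

(** The polynomial G of the overview, for the point z_i. *)
Definition Phi_cofactor (i : 'I_n) : {poly F} := \prod_(j < n | j != i) (w j) ^+ M.

Lemma PhiE (i : 'I_n) : Phi p n M = (w i) ^+ M * Phi_cofactor i.
Proof. by rewrite /Phi (bigD1 i). Qed.

Lemma Phi_overE (i : 'I_n) (l : nat) :
  (l <= M)%N -> Phi_over p M i l = (w i) ^+ (M - l) * Phi_cofactor i.
Proof.
move=> leM; rewrite /Phi_over (PhiE i); exact: divp_XsubC_exp_mul.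
Qed.

Lemma root_Phi_cofactor (i : 'I_n) : ~~ root (Phi_cofactor i) (zvar p i).
Proof.
rewrite rootE horner_prod; apply/prodf_neq0 => j ji.
by rewrite horner_exp hornerXsubC expf_neq0 // subr_eq0 (inj_eq zvar_inj) eq_sym.
Qed.

Lemma Phi_over1_mul (j : 'I_n) : Phi_over p M j 1 * w j = Phi p n M.
Proof. by rewrite /Phi_over expr1 divpK // /Phi (bigD1 j) //= dvdp_mulr // dvdp_exp. Qed.

Lemma Phi_cofactor_divK (i j : 'I_n) :
  j != i -> Phi_cofactor i %/ w j * w j = Phi_cofactor i.
Proof.
move=> ji; rewrite divpK // /Phi_cofactor (bigD1 j) //=.
by rewrite dvdp_mulr // dvdp_exp.
Qed.

Lemma Phi_over1E (i j : 'I_n) : j != i ->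
  Phi_over p M j 1 = (w i) ^+ M * (Phi_cofactor i %/ w j).
Proof.
move=> ji; have w_neq0 : w j != 0 by rewrite polyXsubC_eq0.
by apply: (mulIf w_neq0); rewrite Phi_over1_mul -mulrA Phi_cofactor_divK // (PhiE i).
Qed.

(** The generator Phi / (x - z_i) keeps M - 1 factors x - z_i, the others keep all M. *)
Lemma Omega_log_dvdp (i : 'I_n) (P : {poly F}) :
  Omega_log M P -> (w i) ^+ M.-1 %| P.
Proof.
case=> c ->; apply: dvdp_sum_scale => j _; have [->|ji] := eqVneq j i.
  by rewrite Phi_overE // subn1 dvdp_mulr.
by rewrite (Phi_over1E i) // dvdp_mulr // dvdp_exp2l // leq_pred.
Qed.

Lemma deriv_Phi_over (i : 'I_n) (l : nat) : (l <= M)%N ->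
  ((w i) ^+ (M - l) * Phi_cofactor i)^`()
    = (M - l)%:R *: ((w i) ^+ (M - l.+1) * Phi_cofactor i) + D p M i l
      - \sum_(s < l) C p M i s.+1 *: ((w i) ^+ (M - (l - s)) * Phi_cofactor i).
Proof.
move=> leM; pose g j := Phi_cofactor i %/ w j.
rewrite (deriv_partial_fraction F 'I_n (fun j => j != i) (@zvar p n) _ M l g) //.
- by congr (_ + _ - _); apply: eq_bigr => j ji; rewrite (Phi_over1E i).
- by move=> j ji; rewrite (inj_eq zvar_inj).
- exact: Phi_cofactor_divK.
Qed.

Lemma QansatzE (i : 'I_n) :
  Qansatz M i (fun m => Qcoef i (M - m))
    = \sum_(N < M) Qcoef i N *: Phi_over p M i (M - N).
Proof.
rewrite -(big_mkord predT (fun N => Qcoef i N *: Phi_over p M i (M - N))).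
rewrite big_ltn // subn0 /Qansatz; congr (_ + _).
  (* [Qcoef i 0] is 1: the empty composition counts once, and for m > 0 the numerator is an empty
     sum. *)
  rewrite /Qcoef -(prednK M_gt0) big_ord_recl /= big1 ?addr0 ?scale1r // => m _.
  by rewrite big_ord0 mul0r.
rewrite [RHS]big_nat_rev; apply: eq_big_nat => m m_lt.
by congr (Qcoef _ _ *: Phi_over _ _ _ _); lia.
Qed.

Lemma deriv_QansatzE (i : 'I_n) :
  (Qansatz M i (fun m => Qcoef i (M - m)))^`()
    = \sum_(N < M) Qcoef i N *:
        (D p M i (M - N) - C p M i (M - N) *: Phi_over p M i 1).
Proof.
pose T l := (w i) ^+ (M - l) * Phi_cofactor i.
rewrite QansatzE (eq_bigr (fun N : 'I_M => Qcoef i N *: T (M - N)%N)); last first.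
  by move=> N _; rewrite Phi_overE ?leq_subr.
rewrite (Phi_overE i 1) //; apply: deriv_sum_telescope => [l|N ltNM].
  exact: deriv_Phi_over.
(* At N = 0 the recursion reads 0 = 0; for 0 < N < M the factor N is invertible. *)
have [->|N_gt0] := posnP N; first by rewrite mul0r big_ord0.
by apply: sum_comp_weight_rec => //; apply: natr_Fpz_neq0; rewrite N_gt0.
Qed.

(** * Closure properties of [Omega_log] and uniqueness of the ansatz *)

Lemma Omega_log_Phi_over (j : 'I_n) (a : F) : Omega_log M (a *: Phi_over p M j 1).
Proof.
exists (fun u => if u == j then a else 0); rewrite (bigD1 j) //= eqxx big1 ?addr0 //.
by move=> u /negPf->; rewrite scale0r.
Qed.

Lemma Omega_logD (P P' : {poly F}) :
  Omega_log M P -> Omega_log M P' -> Omega_log M (P + P').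
Proof.
case=> c -> [c' ->]; exists (fun j => c j + c' j).
by rewrite -big_split; apply: eq_bigr => j _; rewrite scalerDl.
Qed.

Lemma Omega_logZ (a : F) (P : {poly F}) : Omega_log M P -> Omega_log M (a *: P).
Proof.
case=> c ->; exists (fun j => a * c j).
by rewrite scaler_sumr; apply: eq_bigr => j _; rewrite scalerA.
Qed.

Lemma Omega_log_sum (I : Type) (r : seq I) (Q : pred I) (P : I -> {poly F}) :
  (forall u, Q u -> Omega_log M (P u)) -> Omega_log M (\sum_(u <- r | Q u) P u).
Proof.
move=> PQ; apply: big_ind => //; last exact: Omega_logD.
by exists (fun=> 0); rewrite big1 // => j _; rewrite scale0r.
Qed.

Lemma Omega_log_deriv_Qansatz (i : 'I_n) :
  Omega_log M (Qansatz M i (fun m => Qcoef i (M - m)))^`().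
Proof.
rewrite deriv_QansatzE; apply: Omega_log_sum => N _; apply/Omega_logZ/Omega_logD.
  by apply: Omega_log_sum => j _; apply: Omega_log_Phi_over.
by rewrite -scaleNr; apply: Omega_log_Phi_over.
Qed.

Lemma Qansatz_unique (i : 'I_n) (A B : nat -> F) :
  Omega_log M (Qansatz M i A)^`() -> Omega_log M (Qansatz M i B)^`() ->
  Qansatz M i A = Qansatz M i B.
Proof.
move=> QA QB; apply/eqP; rewrite -subr_eq0; apply/eqP.
(* The common term [Phi_over i M] cancels, so only the powers w^1, ..., w^(M-1) occur in R. *)
pose R := \sum_(1 <= m < M) (A m - B m) *: (w i) ^+ (M - m).
have QE : Qansatz M i A - Qansatz M i B = R * Phi_cofactor i.
  rewrite /Qansatz opprD addrACA subrr add0r -sumrB /R mulr_suml.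
  rewrite [LHS]big_nat_cond [RHS]big_nat_cond; apply: eq_bigr => m /andP[m_lt _].
  by rewrite -scalerBl Phi_overE -?scalerAl //; lia.
rewrite QE (eq0_of_dvdp_deriv F (zvar p i) M (Phi_cofactor i) R) ?mul0r //.
- exact: natr_Fpz_neq0.
- exact: root_Phi_cofactor.
- rewrite /R big_nat_cond; apply: (big_ind (fun P : {poly F} => (size P <= M)%N)).
  + by rewrite size_poly0.
  + by move=> P P' sP sP'; rewrite (leq_trans (size_polyD _ _)) // geq_max sP.
  + move=> m /andP[m_lt _]; apply: leq_trans (size_scale_leq _ _) _.
    by rewrite size_exp_XsubC; lia.
- rewrite /R big_nat_cond; apply: dvdp_sum_scale => m /andP[m_lt _].
  by rewrite dvdp_exp //; lia.
- rewrite -QE derivB; apply: dvdp_sub; exact: Omega_log_dvdp.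
Qed.

(** The explicit coefficients witness existence, so the chosen ones satisfy the defining property
    too, and uniqueness identifies the two polynomials. *)
Lemma Q_eq_Qansatz (i : 'I_n) : Q p M i = Qansatz M i (fun m => Qcoef i (M - m)).
Proof.
apply: Qansatz_unique (Omega_log_deriv_Qansatz i).
apply: (ClassicalEpsilon.epsilon_spec _ (fun A => Omega_log M (Qansatz M i A)^`())).
by exists (fun m => Qcoef i (M - m)); apply: Omega_log_deriv_Qansatz.
Qed.

End LogAnsatz.

Theorem theorem4p3 (p q k n a M : nat)
  (p_prime : prime p) (q_prime : prime q) (k_gt0 : (0 < k)%N)
  (n_def : n = (k * q + 1)%N) (n_lt_p : (n < p)%N)
  (a_bounds : (1 <= a < q)%N) (a_dvd : (q %| a * p - 1)%N)
  (M_def : M = ((a * p - 1) %/ q)%N) (i : 'I_n) :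
  Q p M i
    = @sum_compositions p n M (fun m l =>
        Cprod p i l *: Phi_over p M i (l ord0))
  /\
  (Q p M i)^`()
    = @sum_compositions p n M (fun m l =>
        Cprod p i l *: (D p M i (l ord0) - C p M i (l ord0) *: Phi_over p M i 1)).
Proof.
have q_gt0 := prime_gt0 q_prime; have p_gt0 := prime_gt0 p_prime.
(* Here a p - 1 >= q, because p > n = k q + 1 > q. *)
have M_gt0 : (0 < M)%N.
  rewrite M_def divn_gt0 //.
  have := leq_pmull q k_gt0; have := leq_pmull p (proj1 (andP a_bounds)); lia.
(* From a < q follows a p - 1 < q p. *)
have ltMp : (M < p)%N.
  rewrite M_def ltn_divLR //; case/andP: a_bounds => _ ltaq.
  have : (a * p < q * p)%N by rewrite ltn_pmul2r.
  by rewrite [(p * q)%N]mulnC; lia.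
rewrite (sum_compositionsE _ _ _ i (Phi_over p M i)).
rewrite (sum_compositionsE _ _ _ i (fun h => D p M i h - C p M i h *: Phi_over p M i 1)).
rewrite Q_eq_Qansatz //; split; first exact: QansatzE.
exact: deriv_QansatzE.
Qed.
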